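(* For every rising tree $T$, with Farey-indexed numbers $m_q$, $$2\,\mathrm{Area}(\mathcal W_T)=\frac1{\rho(m_0)\rho(m_1)}+\sum_{q\in\mathbb Q\cap(0,1)}\frac{\rho(m_{q_0})+\rho(m_{q_0'})-\rho(m_q)}{\rho(m_{q_0})\,\rho(m_{q_0'})\,\rho(m_q)}.$$
   Context: All fractions $k/n$ are in lowest terms with $n\ge1$. Two fractions $a/b<c/d$ in $[0,1]$ are Farey neighbours if $bc-ad=1$; their mediant is $(a+c)/(b+d)$. Each $q\in\mathbb Q\cap(0,1)$ is the mediant of a unique pair of Farey neighbours in $[0,1]$, denoted $q_0<q_0'$. Let $\rho(x)=\cosh^{-1}(x/2)$ for $x\ge2$. A real Markov tree $T$ with base triple $(s_0,u_0,t_0)\in\mathbb R^3$ is a rooted planar trivalent tree (the root has degree 1, all other vertices degree 3) whose complementary regions carry real labels; the root edge has the region $s_0$ on its left, $t_0$ on its right, and leads to the region $u_0$; and for every non-root edge, with regions $s,t$ on its two sides and $r,u$ at its two ends, $r+u=st$. The regions are Farey-indexed by $\mathbb Q\cap[0,1]$, writing $m_q=m(T)_q$: $m_0=s_0$, $m_{1/2}=u_0$, $m_1=t_0$, and for each $q\in\mathbb Q\cap(0,1)$, if $p$ is the mediant of $q_0,q$ and $p'$ the mediant of $q,q_0'$, then $m_p=m_{q_0}m_q-m_{q_0'}$ and $m_{p'}=m_qm_{q_0'}-m_{q_0}$. The non-root vertices correspond to $q\in\mathbb Q\cap(0,1)$: the regions $q_0,q,q_0'$ meet at vertex $q$. Let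 $e_q$ be the edge at vertex $q$ on the side of the root. It is (positively) directed away from the root if $2m_q-m_{q_0}m_{q_0'}>0$, towards the root if this is negative, and undirected if it is $0$. $T$ is a rising tree if all labels are $>2$ and all edges are positively directed away from the root except for those on a finite (possibly empty) simple path starting at the root. The encoding function $\Phi_T:[0,1]\to\mathbb R_{\ge0}$ is the unique continuous function with $\Phi_T(k/n)=\rho(m_{k/n})/n$ for all $k/n\in\mathbb Q\cap[0,1]$ (it exists for rising trees). The wedge $\mathcal W_T$ is the region, in polar coordinates, $\{(r\cos\theta,r\sin\theta): 0\le\theta\le\pi/4,\ 0\le r\le f(\theta)\}$, where $f(\theta)=\dfrac1{\cos(\theta)\,\Phi_T(\tan\theta)}$. *)

(* Defs.v *)
From HB Require Import structures.
From mathcomp Require Import all_boot all_order all_algebra.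
From mathcomp Require Import all_classical all_reals all_analysis.
Set Implicit Arguments.
Unset Strict Implicit.
Unset Printing Implicit Defensive.
Import Order.TTheory GRing.Theory Num.Theory numFieldNormedType.Exports.
Local Open Scope classical_set_scope.
Local Open Scope ring_scope.

Definition cosh {R : realType} (x : R) : R := (expR x + expR (- x)) / 2.

(* For y < 1 the set below is empty and the value is arbitrary. *)
Definition arccosh {R : realType} (y : R) : R :=
  get [set t : R | 0 <= t /\ cosh t = y].

Definition rho {R : realType} (x : R) : R := arccosh (x / 2).

(* [numq] and [denq] are the numerator and the (positive) denominator of the
   fraction in lowest terms; in particular 0 = 0/1 and 1 = 1/1. *)
Definition farey_neighbours (p q : rat) : Prop :=
  [/\ 0 <= p, p < q, q <= 1 & denq p * numq q - numq p * denq q = 1].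

Definition mediant (p q : rat) : rat :=
  (numq p + numq q)%:~R / (denq p + denq q)%:~R.

(* For 0 < q < 1 there is exactly one such pair; the default (0, 1) is only
   reached for q outside ]0, 1[. *)
Definition farey_parents (q : rat) : rat * rat :=
  xget (0, 1) [set p | farey_neighbours p.1 p.2 /\ q = mediant p.1 p.2].

Definition parentl (q : rat) : rat := (farey_parents q).1.
Definition parentr (q : rat) : rat := (farey_parents q).2.

(* The tree is carried by its Farey indexing: the regions are the rationals of
   [0, 1], and the non-root vertices, as well as the edges (e_q joins the vertex
   q to the next vertex on the side of the root), are the rationals of ]0, 1[.
   The children of the vertex q are mediant (parentl q) q and
   mediant q (parentr q).  The values of m outside [0, 1] are irrelevant. *)
Record markov_tree {R : realType} (s0 u0 t0 : R) (m : rat -> R) : Prop :=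
  MarkovTree {
    markov_tree_base0 : m 0 = s0;
    markov_tree_base_half : m (1 / 2) = u0;
    markov_tree_base1 : m 1 = t0;
    markov_tree_edgel : forall q : rat, 0 < q < 1 ->
      m (mediant (parentl q) q) = m (parentl q) * m q - m (parentr q);
    markov_tree_edger : forall q : rat, 0 < q < 1 ->
      m (mediant q (parentr q)) = m q * m (parentr q) - m (parentl q)
  }.

Definition directed_away {R : realType} (m : rat -> R) (q : rat) : Prop :=
  0 < 2 * m q - m (parentl q) * m (parentr q).

Definition child (q p : rat) : bool :=
  (p == mediant (parentl q) q) || (p == mediant q (parentr q)).

(* A simple path of a rooted tree that starts at the root always descends, so it
   is given by its successive non-root vertices; it consists of the edges e_q
   for q in the list. The only neighbour of the root is the vertex 1/2. *)
Definition root_path (s : seq rat) : bool :=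
  if s is q :: s' then (q == 1 / 2) && path child q s' else true.

Definition rising {R : realType} (m : rat -> R) : Prop :=
  (forall q : rat, 0 <= q <= 1 -> 2 < m q) /\
  (exists2 s : seq rat, root_path s &
    forall q : rat, 0 < q < 1 -> q \notin s -> directed_away m q).

Definition is_encoding {R : realType} (m : rat -> R) (Phi : R -> R) : Prop :=
  [/\ forall x : R, 0 <= x <= 1 -> 0 <= Phi x,
      {within `[0, 1], continuous Phi} &
      forall q : rat, 0 <= q <= 1 -> Phi (ratr q) = rho (m q) / (denq q)%:~R].

(* Only the values on [0, 1], which [is_encoding] determines, are used. *)
Definition encoding {R : realType} (m : rat -> R) : R -> R :=
  get [set Phi : R -> R | is_encoding m Phi].

Definition wedge_radius {R : realType} (m : rat -> R) (theta : R) : R :=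
  1 / (cos theta * encoding m (tan theta)).

Definition wedge {R : realType} (m : rat -> R) : set (R * R) :=
  [set z | exists r theta : R,
    [/\ 0 <= theta <= pi / 4, 0 <= r <= wedge_radius m theta &
        z = (r * cos theta, r * sin theta)]].

Definition area {R : realType} (A : set (R * R)) : \bar R :=
  ((@lebesgue_measure R) \x (@lebesgue_measure R))%E A.

Definition sum_term {R : realType} (m : rat -> R) (q : rat) : R :=
  (rho (m (parentl q)) + rho (m (parentr q)) - rho (m q)) /
  (rho (m (parentl q)) * rho (m (parentr q)) * rho (m q)).

(* [\esum] is meant for nonnegative families, so the sum of a signed summable
   family is the difference of the sums of its positive and negative parts. *)
Definition signed_esum {R : realType} {I : choiceType} (D : set I)
    (f : I -> \bar R) : \bar R :=
  (\esum_(i in D) f^\+ i - \esum_(i in D) f^\- i)%E.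

(* Main.v *)
(* Write [n] for the denominator of [q] and [phi q = rho (m q) / n], and let
   [q0, q0'] be the parents of [q].

   The polynomial [x^2 + y^2 + z^2 - xyz - 4] takes the same value on all triples
   of regions meeting at a vertex, and it factors through [2 cosh (a +- b)]; on
   edges directed away from the root, where [m q / 2] is at least the product of
   the [m / 2] of the parents, this gives [rho (m q) >= c n] and then
   [rho (m q) = rho (m q0) + rho (m q0') + O(1/n^2)].  Hence the slopes of [phi]
   between Farey neighbours are bounded, [phi] is Lipschitz, and it extends to
   the encoding function, which is bounded below by a positive constant.

   The boundary point of the wedge in the direction of [k/n] is
   [(n, k) / rho (m q)], so the triangle spanned by two Farey neighbours [p, q]
   has twice the area [1 / (rho (m p) rho (m q))], and the term of the series at
   [q] is the change of this quantity when the mediant [q] is inserted.  The sum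
   over the first levels of the tree telescopes to the area of a polygon, which
   differs from the corresponding sectors of the wedge by [O(|q - p|^2)]. *)
Require Import Defs.
From HB Require Import structures.
From mathcomp Require Import all_boot all_order all_algebra.
From mathcomp Require Import all_classical all_reals all_analysis.
From mathcomp Require Import measurable_realfun ring lra zify.
Set Implicit Arguments.
Unset Strict Implicit.
Unset Printing Implicit Defensive.
Import Order.TTheory GRing.Theory Num.Theory numFieldNormedType.Exports.
Local Open Scope classical_set_scope.
Local Open Scope ring_scope.

(** * Hyperbolic functions *)

Section hyperbolic.
Context {R : realType}.
Implicit Types a b c x y : R.

Definition sinh x : R := (expR x - expR (- x)) / 2.

Lemma coshD x y : cosh (x + y) = cosh x * cosh y + sinh x * sinh y.
Proof. by rewrite /cosh /sinh opprD !expRD; field. Qed.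

Lemma coshN x : cosh (- x) = cosh x.
Proof. by rewrite /cosh opprK addrC. Qed.

Lemma sinhN x : sinh (- x) = - sinh x.
Proof. by rewrite /sinh opprK -mulNr opprB. Qed.

Lemma coshB x y : cosh (x - y) = cosh x * cosh y - sinh x * sinh y.
Proof. by rewrite coshD coshN sinhN mulrN. Qed.

Lemma cosh0 : cosh 0 = 1 :> R.
Proof. by rewrite /cosh oppr0 expR0; field. Qed.

Lemma cosh2_sinh2 x : cosh x ^+ 2 - sinh x ^+ 2 = 1.
Proof. by rewrite !expr2 -coshB subrr cosh0. Qed.

Lemma sinh_ge x : 0 <= x -> x / 2 <= sinh x.
Proof.
move=> x0; rewrite /sinh ler_pM2r ?invr_gt0//.
have h1 := expR_ge1Dx x.
have h2 : expR (- x) <= 1 by rewrite expR_le1 oppr_le0.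
lra.
Qed.

Lemma cosh_le_expR x : 0 <= x -> cosh x <= expR x.
Proof.
move=> x0; have : expR (- x) <= expR x by rewrite ler_expR; lra.
by rewrite /cosh; lra.
Qed.

(** The difference equals [2 * (sinh u * sinh v)] at the half-sum [u] and the half-difference [v],
    and [sinh_ge] applies to both factors. *)
Lemma coshB_ge x y : 0 <= x -> x <= y -> (y - x) * (y + x) / 8 <= cosh y - cosh x.
Proof.
move=> x0 xy; set u := (y + x) / 2; set v := (y - x) / 2.
have -> : cosh y - cosh x = 2 * (sinh u * sinh v).
  have -> : y = u + v by rewrite /u /v; field.
  have -> : x = u - v by rewrite /u /v; field.
  by rewrite coshD coshB; ring.
have u0 : 0 <= u by rewrite /u; lra.
have v0 : 0 <= v by rewrite /v; lra.
have h : u / 2 * (v / 2) <= sinh u * sinh v.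
  by apply: ler_pM; rewrite ?sinh_ge// divr_ge0.
have -> : (y - x) * (y + x) / 8 = 2 * (u / 2 * (v / 2)) by rewrite /u /v; field.
lra.
Qed.

Lemma dist_cosh_ge x y : 0 <= x -> 0 <= y ->
  `|x - y| * (x + y) / 8 <= `|cosh x - cosh y|.
Proof.
move=> x0 y0; wlog xy : x y x0 y0 / x <= y.
  move=> h; have [/h|/ltW/h] := leP x y; first exact.
  by rewrite (distrC x) (distrC (cosh x)) (addrC x); exact.
have h := coshB_ge x0 xy.
have h0 : 0 <= (y - x) * (y + x) / 8 by rewrite !mulr_ge0//; lra.
by rewrite !ler0_norm; lra.
Qed.

(* [2 cosh (a + b)] and [2 cosh (a - b)] are the values of [z] at which the
   invariant [x^2 + y^2 + z^2 - xyz - 4] vanishes for [x = 2 cosh a] and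
   [y = 2 cosh b]. *)
Definition markov_form (x y z : R) := x ^+ 2 + y ^+ 2 + z ^+ 2 - x * y * z - 4.

Lemma markov_form_cosh a b z :
  markov_form (2 * cosh a) z (2 * cosh b) =
  (z - 2 * cosh (a + b)) * (z - 2 * cosh (a - b)).
Proof.
rewrite /markov_form coshD coshB; have := cosh2_sinh2 a; have := cosh2_sinh2 b.
set ca := cosh a; set sa := sinh a; set cb := cosh b; set sb := sinh b => hb ha.
have ea : sa ^+ 2 = ca ^+ 2 - 1 by rewrite -ha; ring.
have eb : sb ^+ 2 = cb ^+ 2 - 1 by rewrite -hb; ring.
have -> : (z - 2 * (ca * cb + sa * sb)) * (z - 2 * (ca * cb - sa * sb)) =
   z ^+ 2 - 4 * z * (ca * cb) + 4 * (ca ^+ 2 * cb ^+ 2 - sa ^+ 2 * sb ^+ 2) by ring.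
by rewrite ea eb; ring.
Qed.

(** By [markov_form_cosh] the form is [4] times the product of [cosh c - cosh (a + b)] and
    [cosh c - cosh (a - b)]. The hypothesis on [cosh c] keeps the second factor above
    [sinh a * sinh b >= a * b / 4], and [dist_cosh_ge] bounds the first one below in terms of
    [c - (a + b)]. *)
Lemma excess_bound a b c : 0 <= a -> 0 <= b -> 0 <= c ->
  cosh a * cosh b < cosh c ->
  `|c - (a + b)| * ((a + b) * (a * b)) <=
  8 * `|markov_form (2 * cosh a) (2 * cosh c) (2 * cosh b)|.
Proof.
move=> a0 b0 c0 lt; rewrite markov_form_cosh -!mulrBr normrM.
have ab0 : 0 <= a + b by rewrite addr_ge0.
have h1 : `|c - (a + b)| * (a + b) / 8 <= `|cosh c - cosh (a + b)|.
  apply: le_trans (dist_cosh_ge c0 ab0).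
  by rewrite ler_pM2r ?invr_gt0// ler_wpM2l// lerDr.
have h2 : a / 2 * (b / 2) <= cosh c - cosh (a - b).
  apply: (@le_trans _ _ (sinh a * sinh b)).
    by apply: ler_pM; rewrite ?sinh_ge// divr_ge0.
  by rewrite coshB; lra.
have p1 : 0 <= `|c - (a + b)| * (a + b) / 8 by rewrite !mulr_ge0.
have p2 : 0 <= a / 2 * (b / 2) by rewrite !mulr_ge0.
rewrite !normrM (ger0_norm (x := 2))// (ger0_norm (x := cosh c - cosh (a - b))).
  have := ler_pM p1 p2 h1 h2; set u := `|_|; set v := `|_|; lra.
exact: le_trans h2.
Qed.

Lemma arccosh_spec y : 1 <= y -> 0 <= arccosh y /\ cosh (arccosh y) = y.
Proof.
move=> y1; apply: (@getPex _ [set t | 0 <= t /\ cosh t = y]).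
have r0 : 0 <= y ^+ 2 - 1 by rewrite subr_ge0 exprn_ege1.
have s0 := sqrtr_ge0 (y ^+ 2 - 1).
(* The witness is the logarithm of the root [y + sqrt (y ^+ 2 - 1)] of [z ^+ 2 - 2 * y * z + 1]; the
   inverse of this root is the conjugate root. *)
have e1 : 1 <= y + Num.sqrt (y ^+ 2 - 1) by lra.
have e0 : 0 < y + Num.sqrt (y ^+ 2 - 1) by lra.
have [t et] := expR_total e0.
exists t; split; first by rewrite leNgt -expR_lt1 -leNgt et.
rewrite /cosh expRN et.
have -> : (y + Num.sqrt (y ^+ 2 - 1))^-1 = y - Num.sqrt (y ^+ 2 - 1).
  apply: (mulfI (lt0r_neq0 e0)); rewrite divff ?lt0r_neq0//.
  by rewrite mulrC -subr_sqr sqr_sqrtr//; ring.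
by field.
Qed.

Lemma rho_ge0 x : 2 <= x -> 0 <= rho x.
Proof. by move=> x2; apply: (arccosh_spec _).1; lra. Qed.

Lemma cosh_rho x : 2 <= x -> 2 * cosh (rho x) = x.
Proof. by move=> x2; rewrite (arccosh_spec _).2; [field|lra]. Qed.

(** The logarithm turns the products of labels in the direction condition into sums. *)
Lemma rho_ge_ln x : 2 <= x -> ln (x / 2) <= rho x.
Proof.
move=> x2; rewrite -[leRHS]expRK ler_ln ?posrE ?expR_gt0//; last by lra.
by rewrite -[X in X / 2](cosh_rho x2) mulrC mulKf// cosh_le_expR// rho_ge0.
Qed.

End hyperbolic.

(** * Farey neighbours *)

Lemma ltr_numq_denq (p q : rat) : (p < q) = (numq p * denq q < numq q * denq p).
Proof.
rewrite -[p in LHS]divq_num_den -[q in LHS]divq_num_den.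
by rewrite ltr_pdivrMr ?ltr0z// mulrAC ltr_pdivlMr ?ltr0z// -!intrM ltr_int.
Qed.

Lemma eq_numq_denq (p q : rat) : numq p = numq q -> denq p = denq q -> p = q.
Proof. by move=> h1 h2; rewrite -(divq_num_den p) h1 h2 divq_num_den. Qed.

Section neighbours.
Variables (p q : rat) (pq : farey_neighbours p q).

Lemma mediant_coprime : coprime `|numq p + numq q| `|denq p + denq q|.
Proof.
case: pq => _ _ _ h.
(* Bezout coefficients: adding [p] to [q] does not change the determinant with [p]. *)
rewrite -coprimezE; apply/coprimezP; exists (denq p, - numq p) => /=.
rewrite -h; ring.
Qed.

Lemma numq_mediant : numq (mediant p q) = numq p + numq q.
Proof.
rewrite /mediant coprimeq_num ?mediant_coprime//.
by rewrite gtr0_sg ?mul1r// addr_gt0.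
Qed.

Lemma denq_mediant : denq (mediant p q) = denq p + denq q.
Proof.
rewrite /mediant coprimeq_den ?mediant_coprime//.
have h : 0 < denq p + denq q by rewrite addr_gt0.
by rewrite gt_eqF// gtr0_norm.
Qed.

Lemma mediant_gt : p < mediant p q.
Proof.
case: pq => _ + _ _; rewrite !ltr_numq_denq numq_mediant denq_mediant => h.
by rewrite mulrDr mulrDl mulrC; lia.
Qed.

Lemma mediant_lt : mediant p q < q.
Proof.
case: pq => _ + _ _; rewrite !ltr_numq_denq numq_mediant denq_mediant => h.
by rewrite mulrDr mulrDl mulrC; lia.
Qed.

Lemma farey_mediantl : farey_neighbours p (mediant p q).
Proof.
have pm := mediant_gt; have /ltW mq := mediant_lt; case: pq => p0 _ q1 h.
split; rewrite ?(le_trans mq)// numq_mediant denq_mediant.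
by rewrite !mulrDr (mulrC (denq p)); lia.
Qed.

Lemma farey_mediantr : farey_neighbours (mediant p q) q.
Proof.
have mq := mediant_lt; have /ltW pm := mediant_gt; case: pq => p0 _ q1 h.
split; rewrite ?(le_trans p0)// numq_mediant denq_mediant.
by rewrite !mulrDl (mulrC (denq q)); lia.
Qed.

End neighbours.

(** Uniqueness of the parents. A left parent [p] of [x] satisfies
    [denq p * numq x - numq p * denq x = 1], so the denominators of two left parents are congruent
    modulo [denq x]; both lie strictly between [0] and [denq x], hence they agree. *)
Lemma farey_parents_mediant (p q : rat) : farey_neighbours p q ->
  farey_parents (mediant p q) = (p, q).
Proof.
move=> pq; set x := mediant p q; rewrite /farey_parents.
case: (xgetP (0, 1) [set y | farey_neighbours y.1 y.2 /\ x = mediant y.1 y.2]).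
  move=> [p' q'] _ [/= pq' e].
  have hn : numq p + numq q = numq p' + numq q'.
    by rewrite -!numq_mediant// -e.
  have hd : denq p + denq q = denq p' + denq q'.
    by rewrite -!denq_mediant// -e.
  case: (pq) => _ _ _ h; case: (pq') => _ _ _ h'.
  have dvd : (denq x %| (denq p - denq p') * numq x)%Z.
    apply/dvdzP; exists (numq p - numq p').
    rewrite denq_mediant// numq_mediant//.
    suff : denq p * (numq p + numq q) - numq p * (denq p + denq q) =
           denq p' * (numq p + numq q) - numq p' * (denq p + denq q) by lia.
    have -> : denq p * (numq p + numq q) - numq p * (denq p + denq q) = 1.
      by rewrite -h; ring.
    by rewrite {1}hn {1}hd -h'; ring.
  have ed : denq p = denq p'.
    move: dvd; rewrite Gauss_dvdzl; last first.
      rewrite coprimezE coprime_sym; exact: coprime_num_den.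
    rewrite denq_mediant// => /dvdzP[z ez].
    have [p1 p2 p3 p4] : [/\ 0 < denq p, 0 < denq p', 0 < denq q & 0 < denq q'] by [].
    have z0 : z = 0.
      have [zp|zn|//] := ltgtP z 0.
        suff : z * (denq p + denq q) <= (-1) * (denq p + denq q) by lia.
        by rewrite ler_wpM2r; lia.
      suff : 1 * (denq p + denq q) <= z * (denq p + denq q) by lia.
      by rewrite ler_wpM2r; lia.
    by move: ez; rewrite z0 mul0r => /eqP; rewrite subr_eq0 => /eqP.
  have ed' : denq q = denq q' by lia.
  have en : numq p = numq p'.
    have hh : (numq p - numq p') * (denq p + denq q) = 0.
      have h1 : denq p * (numq p + numq q) - numq p * (denq p + denq q) = 1.
        by rewrite -h; ring.
      have h2 : denq p * (numq p + numq q) - numq p' * (denq p + denq q) = 1.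
        by rewrite {1}ed hn hd -h'; ring.
      by rewrite mulrBl; lia.
    move/eqP: hh; rewrite mulf_eq0 subr_eq0 => /orP[/eqP//|].
    by rewrite gt_eqF// addr_gt0.
  have en' : numq q = numq q' by lia.
  by congr (_, _); apply: eq_numq_denq.
(* The default value of [xget] cannot occur, since [(p, q)] belongs to the set. *)
by move=> h; case: (h (p, q)).
Qed.

Lemma parentl_mediant (p q : rat) : farey_neighbours p q -> parentl (mediant p q) = p.
Proof. by move=> pq; rewrite /parentl farey_parents_mediant. Qed.

Lemma parentr_mediant (p q : rat) : farey_neighbours p q -> parentr (mediant p q) = q.
Proof. by move=> pq; rewrite /parentr farey_parents_mediant. Qed.

(* The pairs of regions adjacent to an edge of the tree. *)
Inductive fpair : rat -> rat -> Prop :=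
| fpair_root : fpair 0 1
| fpair_left p q : fpair p q -> fpair p (mediant p q)
| fpair_right p q : fpair p q -> fpair (mediant p q) q.

Lemma fpair_neighbours p q : fpair p q -> farey_neighbours p q.
Proof.
elim=> [|{}p {}q _|{}p {}q _]; first by split.
- exact: farey_mediantl.
- exact: farey_mediantr.
Qed.

(** By the determinant relation, [denq x] is a sum of [denq p] and [denq q] with positive integer
    weights. *)
Lemma denq_between p q x : farey_neighbours p q -> p < x -> x < q ->
  denq p + denq q <= denq x.
Proof.
case=> _ _ _ h; rewrite !ltr_numq_denq => h1 h2.
have -> : denq x = denq p * (numq q * denq x - numq x * denq q) +
                   denq q * (numq x * denq p - numq p * denq x).
  by rewrite -[LHS]mulr1 -h; ring.
by apply: lerD; rewrite ler_peMr//; lia.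
Qed.

(** The path from a pair down to the vertex [x] is finite: [denq x - (denq p + denq q)] is
    nonnegative by [denq_between] and drops at each mediant. The property is then carried back up
    this path. *)
Lemma fpair_descent (x : rat) (P : rat -> rat -> Prop) :
  (forall p q, fpair p q -> x = mediant p q -> P p q) ->
  (forall p q, fpair p q -> x < mediant p q -> P p (mediant p q) -> P p q) ->
  (forall p q, fpair p q -> mediant p q < x -> P (mediant p q) q -> P p q) ->
  forall p q, fpair p q -> p < x -> x < q -> P p q.
Proof.
move=> Pm Pl Pr p q; have [N] := ubnP (absz (denq x - (denq p + denq q))%R).
elim: N p q => // N IH p q; rewrite ltnS => hN pq px xq.
have fpq := fpair_neighbours pq; have := denq_between fpq px xq.
move: (denq_gt0 p) (denq_gt0 q) => dp dq hx.
case: (ltgtP x (mediant p q)) => [lt|gt|e]; last exact: Pm.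
- apply: Pl => //; apply: IH => //; last exact: fpair_left.
  have := denq_between (farey_mediantl fpq) px lt.
  by rewrite denq_mediant//; lia.
- apply: Pr => //; apply: IH => //; last exact: fpair_right.
  have := denq_between (farey_mediantr fpq) gt xq.
  by rewrite denq_mediant//; lia.
Qed.

Lemma fpair_mediant (x : rat) : 0 < x < 1 ->
  exists p q, fpair p q /\ x = mediant p q.
Proof.
case/andP=> x0 x1.
apply: (@fpair_descent x (fun _ _ => exists p q, fpair p q /\ x = mediant p q)
  _ _ _ 0 1) => // [p q pq xm|]; last exact: fpair_root.
by exists p, q.
Qed.

(** * Growth of the labels *)

Lemma fpair_bounds p q : fpair p q ->
  [/\ 0 <= p <= 1, 0 <= q <= 1 & 0 < mediant p q < 1].
Proof.
move=> /fpair_neighbours pq; have pm := mediant_gt pq; have mq := mediant_lt pq.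
have [p0 lpq q1 _] := pq; split; lra.
Qed.

(** The property holds at both ends of every [fpair], by induction on its construction, and every
    fraction of []0, 1[] is the mediant of such a pair. *)
Lemma fpair_ind01 (P : rat -> Prop) : P 0 -> P 1 ->
  (forall p q, fpair p q -> P p -> P q -> P (mediant p q)) ->
  forall x, 0 <= x <= 1 -> P x.
Proof.
move=> P0 P1 Pm.
have Ppq p q : fpair p q -> P p /\ P q.
  by elim=> [|{}p {}q pq [Pp Pq]|{}p {}q pq [Pp Pq]] //; split=> //; exact: Pm.
move=> x /andP[]; rewrite le_eqVlt => /orP[/eqP<-//|x0].
rewrite le_eqVlt => /orP[/eqP->//|x1].
have [|p [q [pq ->]]] := @fpair_mediant x; first by rewrite x0.
by have [Pp Pq] := Ppq _ _ pq; exact: Pm.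
Qed.

Section finite_bounds.
Context {R : realFieldType} {T : eqType}.

Lemma seq_lbound_gt0 (s : seq T) (P : pred T) (f : T -> R) :
  (forall x, x \in s -> P x -> 0 < f x) ->
  exists2 c, 0 < c & forall x, x \in s -> P x -> c <= f x.
Proof.
elim: s => [|y s IH] h; first by exists 1.
have [x xs Px|c c0 hc] := IH; first by apply: h; rewrite // inE xs orbT.
have [Py|nPy] := boolP (P y); last first.
  by exists c => // x; rewrite inE => /orP[/eqP->|/hc//]; rewrite (negbTE nPy).
exists (Num.min c (f y)); first by rewrite lt_min c0 h// mem_head.
move=> x; rewrite inE => /orP[/eqP-> _|xs Px]; first by rewrite ge_min lexx orbT.
by rewrite ge_min hc.
Qed.

Lemma seq_ubound_gt0 (s : seq T) (f : T -> R) :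
  exists2 c, 0 < c & forall x, x \in s -> f x <= c.
Proof.
elim: s => [|y s [c c0 hc]]; first by exists 1.
exists (Num.max c (f y)); first by rewrite lt_max c0.
move=> x; rewrite inE le_max => /orP[/eqP->|/hc->//].
by rewrite lexx orbT.
Qed.

End finite_bounds.

Section den.
Context {R : realType}.

Definition den (q : rat) : R := (denq q)%:~R.

Lemma den_ge1 q : 1 <= den q.
Proof. by rewrite /den ler1z; have := denq_gt0 q; lia. Qed.

Lemma den_gt0 q : 0 < den q.
Proof. exact: lt_le_trans (den_ge1 q). Qed.

Lemma den_mediant p q : fpair p q -> den (mediant p q) = den p + den q.
Proof. by move=> /fpair_neighbours pq; rewrite /den denq_mediant// intrD. Qed.

Lemma fpair_sub p q : fpair p q -> ratr q - ratr p = (den p * den q)^-1 :> R.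
Proof.
move=> /fpair_neighbours [_ _ _ h].
rewrite /ratr -/(den p) -/(den q).
have dp := lt0r_neq0 (den_gt0 p); have dq := lt0r_neq0 (den_gt0 q).
have : den p * (numq q)%:~R - (numq p)%:~R * den q = 1.
  by rewrite /den -!intrM -intrB h.
move: (den p) (den q) dp dq (_%:~R) (_%:~R) => n n' n0 n'0 k k' e.
rewrite -[RHS]mul1r -[in RHS]e; field; exact/andP.
Qed.

End den.

Section estimates.
Context {R : realType} (s0 u0 t0 : R) (m : rat -> R).
Hypotheses (mt : markov_tree s0 u0 t0 m) (rm : rising m).

Let m_gt2 q : 0 <= q <= 1 -> 2 < m q := rm.1 q.

Lemma rho_m_gt0 q : 0 <= q <= 1 -> 0 < rho (m q).
Proof.
move=> /m_gt2 h; rewrite lt_neqAle rho_ge0 ?(ltW h)// andbT eq_sym.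
apply/eqP => e; have := cosh_rho (ltW h); rewrite e cosh0; lra.
Qed.

(** The form is a monic quadratic in each argument, and the edge relation replaces one label by the
    other root (Vieta), so the form is constant on the tree. *)
Lemma markov_form_fpair p q : fpair p q ->
  markov_form (m p) (m (mediant p q)) (m q) = markov_form s0 u0 t0.
Proof.
elim=> [|{}p {}q pq <-|{}p {}q pq <-].
- have -> : mediant 0 1 = 1 / 2 by [].
  by rewrite (markov_tree_base0 mt) (markov_tree_base1 mt) (markov_tree_base_half mt).
- have [_ _ x01] := fpair_bounds pq; have := markov_tree_edgel mt x01.
  have f := fpair_neighbours pq; rewrite parentl_mediant// parentr_mediant// => ->.
  by rewrite /markov_form; ring.
- have [_ _ x01] := fpair_bounds pq; have := markov_tree_edger mt x01.
  have f := fpair_neighbours pq; rewrite parentl_mediant// parentr_mediant// => ->.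
  by rewrite /markov_form; ring.
Qed.

Lemma directed_away_mediant p q : fpair p q -> directed_away m (mediant p q) ->
  m p * m q < 2 * m (mediant p q).
Proof.
move=> /fpair_neighbours pq; rewrite /directed_away.
by rewrite parentl_mediant// parentr_mediant// subr_gt0.
Qed.

(* [ln (m_q / 2)] is superadditive along the edges directed away from the root. *)
Lemma rho_lower_bound : exists2 c : R, 0 < c &
  forall q, 0 <= q <= 1 -> c * den q <= rho (m q).
Proof.
have [s _ hs] := rm.2.
have ln0 q : 0 <= q <= 1 -> 0 < ln (m q / 2).
  by move=> /m_gt2 h; apply: ln_gt0; lra.
(* The induction below starts at [0] and [1] and starts afresh at each exceptional vertex, so [c]
   bounds the ratio from below on this finite list. *)
have [c c0 hc] : exists2 c : R, 0 < c & forall q, q \in [:: 0, 1 & s] ->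
    0 <= q <= 1 -> c <= ln (m q / 2) / den q.
  apply: (@seq_lbound_gt0 _ _ _ (fun q : rat => 0 <= q <= 1)) => q _ q01.
  by rewrite divr_gt0 ?ln0 ?den_gt0.
exists c => // q q01; apply: le_trans (rho_ge_ln (ltW (m_gt2 q01))).
have hc' x : x \in [:: 0, 1 & s] -> 0 <= x <= 1 -> c * den x <= ln (m x / 2).
  by move=> xs x01; rewrite -ler_pdivlMr ?den_gt0 ?hc.
move: q q01; apply: fpair_ind01 => [||p q pq hp hq].
- by apply: hc'; rewrite ?mem_head//; lra.
- by apply: hc'; rewrite ?inE ?eqxx ?orbT//; lra.
have [p01 q01 x01] := fpair_bounds pq.
have [xs|xs] := boolP (mediant p q \in s).
  by apply: hc'; [rewrite !inE xs !orbT|lra].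
have := directed_away_mediant pq (hs _ x01 xs) => lt.
rewrite den_mediant// mulrDr; apply: (le_trans (lerD hp hq)).
have mp := m_gt2 p01; have mq := m_gt2 q01.
(* In terms of the halved labels, the direction condition says that the product at [p] and [q] is
   less than the value at the mediant. *)
rewrite -lnM ?posrE; [|lra|lra].
have lp : 0 < m p * m q by rewrite mulr_gt0//; lra.
rewrite ler_ln ?posrE; lra.
Qed.

(** Off the exceptional path [excess_bound] applies, with the constant invariant of the tree on the
    right, while [rho_lower_bound] makes its factor [(a + b) * (a * b)] at least
    [c ^+ 3 * ((n + n') * (n * n'))]. The finitely many exceptional vertices only enlarge the
    constant. *)
Lemma excess_decay : exists2 C : R, 0 < C &
  forall p q, fpair p q ->
  `|rho (m (mediant p q)) - (rho (m p) + rho (m q))| * den (mediant p q) ^+ 2 <= C.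
Proof.
have [s _ hs] := rm.2; have [c c0 hc] := rho_lower_bound.
have [C1 C10 hC1] := seq_ubound_gt0 s (fun x =>
  `|rho (m x) - (rho (m (parentl x)) + rho (m (parentr x)))| * den x ^+ 2).
set E := `|markov_form s0 u0 t0|.
have E0 : 0 <= E by rewrite normr_ge0.
have E3 : 0 <= 16 * E / c ^+ 3.
  by apply: divr_ge0; [exact: mulr_ge0|exact/exprn_ge0/ltW].
exists (C1 + 16 * E / c ^+ 3) => [|p q pq]; first lra.
have fpq := fpair_neighbours pq.
have [xs|xs] := boolP (mediant p q \in s).
  have := hC1 _ xs; rewrite parentl_mediant// parentr_mediant// => h.
  lra.
have [p01 q01 x01] := fpair_bounds pq.
have x01' : 0 <= mediant p q <= 1 by lra.
apply: ler_wpDl; first exact: ltW.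
have lt := directed_away_mediant pq (hs _ x01 xs).
have cp := cosh_rho (ltW (m_gt2 p01)); have cq := cosh_rho (ltW (m_gt2 q01)).
have cx := cosh_rho (ltW (m_gt2 x01')).
have r0 x : 0 <= x <= 1 -> 0 <= rho (m x) by move=> /rho_m_gt0/ltW.
have := excess_bound (r0 _ p01) (r0 _ q01) (r0 _ x01').
rewrite cp cq cx markov_form_fpair// -/E => /(_ _)/wrap[].
  by rewrite -cp -cq -cx in lt; lra.
have hp := hc _ p01; have hq := hc _ q01.
rewrite den_mediant//.
set a := rho (m p) in hp *; set b := rho (m q) in hq *; set d := `|_| => h.
have d0 : 0 <= d by rewrite normr_ge0.
have n1 := @den_ge1 R p; have n2 := @den_ge1 R q.
set n := den p in n1 hp *; set n' := den q in n2 hq *.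
have cn : 0 <= c * n by rewrite mulr_ge0; lra.
have cn' : 0 <= c * n' by rewrite mulr_ge0; lra.
have h1 : (c * n) * (c * n') <= a * b by apply: ler_pM.
have h2 : (c * n + c * n') * ((c * n) * (c * n')) <= (a + b) * (a * b).
  by apply: ler_pM => //; [apply: addr_ge0|apply: mulr_ge0|apply: lerD].
have h3 : d * (c ^+ 3 * ((n + n') * (n * n'))) <= 8 * E.
  apply: le_trans h; apply: ler_wpM2l => //; apply: le_trans h2.
  by rewrite le_eqVlt; apply/orP; left; apply/eqP; ring.
(* Both denominators are at least [1], so [n * n' >= n + n' - 1 >= (n + n') / 2]. *)
have h4 : (n + n') / 2 <= n * n'.
  have : 0 <= (n - 1) * (n' - 1) by rewrite mulr_ge0; lra.
  lra.
have c3 : 0 < c ^+ 3 by rewrite exprn_gt0.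
rewrite ler_pdivlMr// (_ : 16 * E = 2 * (8 * E)); last by ring.
apply: (@le_trans _ _ (2 * (d * (c ^+ 3 * ((n + n') * (n * n')))))); last by lra.
rewrite (_ : d * _ * _ = 2 * (d * (c ^+ 3 * ((n + n') * ((n + n') / 2))))); last by field.
rewrite ler_pM2l// ler_wpM2l// ler_pM2l// ler_wpM2l//; lra.
Qed.

End estimates.

(** * The encoding function *)

Section lipschitz.
Context {R : realType} (f : rat -> R) (L : R).
Hypothesis f_fpair : forall p q, fpair p q -> `|f q - f p| <= L * (ratr q - ratr p).

(** On the descent from the pair to [x], each mediant cuts off an interval between neighbours, and
    the bounds on consecutive intervals add up. *)
Lemma lipschitz_fpair_ends (x : rat) p q : fpair p q -> p < x -> x < q ->
  `|f x - f p| <= L * (ratr x - ratr p) /\ `|f q - f x| <= L * (ratr q - ratr x).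
Proof.
apply: (@fpair_descent x (fun p q => `|f x - f p| <= L * (ratr x - ratr p) /\
  `|f q - f x| <= L * (ratr q - ratr x))) => {}p {}q pq.
- by move=> ->; split; apply: f_fpair; [exact: fpair_left|exact: fpair_right].
- move=> _ [h1 h2]; split=> //; apply: (le_trans (ler_distD (f (mediant p q)) _ _)).
  by have := f_fpair (fpair_right pq); lra.
- move=> _ [h1 h2]; split=> //; apply: (le_trans (ler_distD (f (mediant p q)) _ _)).
  by have := f_fpair (fpair_left pq); lra.
Qed.

(** Descent towards [x] until a mediant equals [x] or [y] or separates them; from there
    [lipschitz_fpair_ends] applies on the sides of the mediant. The ends [0] and [1] come first,
    because the descent needs strict inequalities. *)
Lemma lipschitz_lt (x y : rat) : 0 <= x -> x < y -> y <= 1 ->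
  `|f y - f x| <= L * (ratr y - ratr x).
Proof.
rewrite le_eqVlt => /orP[/eqP<-|x0] xy.
  rewrite le_eqVlt => /orP[/eqP->|y1]; first exact: f_fpair fpair_root.
  by have [] := lipschitz_fpair_ends fpair_root xy y1.
rewrite le_eqVlt => /orP[/eqP ey|y1].
  by rewrite ey in xy *; have [] := lipschitz_fpair_ends fpair_root x0 xy.
have xx1 := lt_trans xy y1.
apply: (@fpair_descent x (fun p q => p < x -> y < q ->
  `|f y - f x| <= L * (ratr y - ratr x)) _ _ _ 0 1) => //; last exact: fpair_root.
- move=> p q pq e _ yq; rewrite e in xy *.
  by have [] := lipschitz_fpair_ends (fpair_right pq) xy yq.
- move=> p q pq xm IH px yq.
  have [|my|e] := ltgtP y (mediant p q); first exact: IH.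
  + have [_ h1] := lipschitz_fpair_ends (fpair_left pq) px xm.
    have [h2 _] := lipschitz_fpair_ends (fpair_right pq) my yq.
    by apply: (le_trans (ler_distD (f (mediant p q)) _ _)); lra.
  + by rewrite e; have [] := lipschitz_fpair_ends (fpair_left pq) px xm.
- by move=> p q pq mx IH px; exact: IH.
Qed.

Lemma lipschitz_rat (x y : rat) : 0 <= x <= 1 -> 0 <= y <= 1 ->
  `|f x - f y| <= L * `|ratr x - ratr y|.
Proof.
wlog xy : x y / x <= y.
  move=> h; have [/h|/ltW/h] := leP x y; first exact.
  by rewrite distrC (distrC (ratr y)) => + ? ?; exact.
move=> /andP[x0 _] /andP[_ y1].
move: xy; rewrite le_eqVlt => /orP[/eqP->|xy]; first by rewrite !subrr !normr0 mulr0.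
rewrite distrC (distrC (ratr x)) (ger0_norm (x := ratr y - _)); last first.
  by rewrite subr_ge0 ler_rat ltW.
exact: lipschitz_lt.
Qed.

End lipschitz.

Section mcshane.
Context {R : realType} (f : rat -> R) (L c : R).
Hypotheses (L0 : 0 <= L) (fc : forall q, 0 <= q <= 1 -> c <= f q).
Hypothesis f_lip : forall x y, 0 <= x <= 1 -> 0 <= y <= 1 ->
  `|f x - f y| <= L * `|ratr x - ratr y|.

Let S (x : R) := [set f q + L * `|x - ratr q| | q in [set q : rat | 0 <= q <= 1]].

Let S_lb x : lbound (S x) c.
Proof.
move=> _ [q /= q01 <-]; apply: (le_trans (fc q01)).
by rewrite lerDl mulr_ge0.
Qed.

Let S_neq0 x : S x !=set0.
Proof. by exists (f 0 + L * `|x - ratr 0|); exists 0 => //=; lra. Qed.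

(** McShane's formula for the largest [L]-Lipschitz extension of [f]. It is defined on the whole
    line, so that the Lipschitz bound and the lower bound [c] hold without restriction to
    [[0, 1]]. *)
Definition mcshane (x : R) : R := inf (S x).

Lemma mcshane_ge x : c <= mcshane x.
Proof. by apply: lb_le_inf; [exact: S_neq0|exact: S_lb]. Qed.

Lemma mcshane_le x q : 0 <= q <= 1 -> mcshane x <= f q + L * `|x - ratr q|.
Proof. by move=> q01; apply: ge_inf; [exists c; exact: S_lb|exists q]. Qed.

Lemma mcshane_rat q : 0 <= q <= 1 -> mcshane (ratr q) = f q.
Proof.
move=> q01; apply/eqP; rewrite eq_le; apply/andP; split.
  by apply: le_trans (mcshane_le _ q01) _; rewrite subrr normr0 mulr0 addr0.
apply: lb_le_inf; first exact: S_neq0.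
move=> _ [p /= p01 <-].
by have := f_lip q01 p01; have := ler_norm (f q - f p); lra.
Qed.

Let mcshane_le_lip x y : mcshane x - L * `|x - y| <= mcshane y.
Proof.
apply: lb_le_inf; first exact: S_neq0.
move=> _ [q /= q01 <-]; have := mcshane_le x q01.
have := ler_wpM2l L0 (ler_distD y x (ratr q)); lra.
Qed.

Lemma mcshane_lip x y : `|mcshane x - mcshane y| <= L * `|x - y|.
Proof.
rewrite ler_norml; have := mcshane_le_lip x y; have := mcshane_le_lip y x.
rewrite (distrC y); lra.
Qed.

End mcshane.

Lemma lipschitz_continuous {R : realType} (f : R -> R) (L : R) :
  (forall x y, `|f x - f y| <= L * `|x - y|) -> continuous f.
Proof.
move=> fL x; apply/cvgrPdist_lt => e e0.
(* This constant is positive whatever the sign of [L]. *)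
have L1 : 0 < `|L| + 1 by rewrite ltr_wpDl.
near=> y; apply: (le_lt_trans (fL x y)).
have h : `|x - y| < e / (`|L| + 1).
  by near: y; exact/(nbhsx_ballx x)/divr_gt0.
apply: (@le_lt_trans _ _ ((`|L| + 1) * `|x - y|)).
  by rewrite ler_wpM2r//; have := ler_norm L; lra.
by rewrite mulrC -ltr_pdivlMr.
Unshelve. all: by end_near. Qed.

Lemma within_continuous_eq_rat {R : realType} (f g : R -> R) :
  {within `[0, 1], continuous f} -> {within `[0, 1], continuous g} ->
  (forall q : rat, 0 <= q <= 1 -> f (ratr q) = g (ratr q)) ->
  forall x : R, 0 <= x <= 1 -> f x = g x.
Proof.
move=> cf cg fg x x01; apply/eqP; rewrite -subr_eq0 -normr_eq0.
rewrite eq_le normr_ge0 andbT; apply/ler_addgt0Pl => e e0; rewrite addr0.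
have xI : `[0%R, 1%R]%classic x by rewrite /= in_itv.
have close (h : R -> R) : {within `[0, 1], continuous h} ->
    exists2 d : R, 0 < d & forall y : R, 0 <= y <= 1 -> `|x - y| < d -> `|h x - h y| < e / 2.
  move=> /subspace_continuousP/(_ x xI)/cvgrPdist_lt/(_ _ (divr_gt0 e0 (ltr0Sn _ 1))).
  move=> [d /= d0 hd].
  exists d => // y y01 xy; apply: (hd y xy).
  by rewrite /= in_itv.
have [d d0 hd] := close _ cf; have [d' d'0 hd'] := close _ cg.
(* A rational is sought in []0, 1[] and within both moduli of continuity; the interval is nonempty
   even when [x] is [0] or [1]. *)
have lt : Num.max 0 (x - Num.min d d') < Num.min 1 (x + Num.min d d').
  by rewrite gt_max !lt_min; case: (ltP d d'); lra.
have [q] := rat_in_itvoo lt.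
rewrite in_itv/= gt_max lt_min => /andP[/andP[q0 q1] /andP[q2 q3]].
have q01 : 0 <= q <= 1.
  rewrite -(ler_rat R 0 q) -(ler_rat R q 1) rmorph0 rmorph1; lra.
have xq : `|x - ratr q| < Num.min d d' by rewrite ltr_norml; lra.
move: xq; rewrite lt_min => /andP[xq xq'].
have r01 : 0 <= (ratr q : R) <= 1 by lra.
have h1 := hd _ r01 xq; have h2 := hd' _ r01 xq'.
rewrite -fg// in h2.
apply: (le_trans (ler_distD (f (ratr q)) _ _)).
rewrite (distrC (f (ratr q))); lra.
Qed.

Section encoding_exists.
Context {R : realType} (s0 u0 t0 : R) (m : rat -> R).
Hypotheses (mt : markov_tree s0 u0 t0 m) (rm : rising m).

(* For neighbours [p, q], the slope between [p] and [q] is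
   [den p * rho (m q) - den q * rho (m p)]; passing to the mediant changes it by
   at most [C * den p / (den p + den q) ^+ 2], whence the telescoping correction
   [2 * C / (den p + den q)]. *)
Lemma encoding_slope : exists2 L : R, 0 < L & forall p q, fpair p q ->
  `|rho (m q) / den q - rho (m p) / den p| <= L * (ratr q - ratr p).
Proof.
have [C C0 hC] := excess_decay mt rm.
pose L := `|rho (m 1) - rho (m 0)| + 2 * C.
have L0 : 0 < L by rewrite ltr_wpDl// mulr_gt0.
(* The factor [2] in the correction absorbs [n + n' + n <= 2 * (n + n')]. *)
have key (n n' d : R) : 1 <= n -> 1 <= n' -> `|d| * (n + n') ^+ 2 <= C ->
    n * `|d| <= 2 * C / (n + n') - 2 * C / (n + n' + n).
  move=> n1 n'1 hd.
  have -> : 2 * C / (n + n') - 2 * C / (n + n' + n) =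
      n * (2 * C / ((n + n') * (n + n' + n))).
    by field; apply/andP; split; apply: lt0r_neq0; lra.
  rewrite ler_wpM2l//; first lra.
  have p1 : 0 < n + n' by lra.
  have p2 : 0 < n + n' + n by lra.
  rewrite ler_pdivlMr ?mulr_gt0//; apply: (@le_trans _ _ (2 * (`|d| * (n + n') ^+ 2))); last lra.
  rewrite (_ : 2 * _ = `|d| * ((n + n') * (2 * (n + n')))); last by ring.
  by rewrite ler_wpM2l// ler_wpM2l//; lra.
have slope p q : fpair p q ->
    `|den p * rho (m q) - den q * rho (m p)| <= L - 2 * C / (den p + den q).
  elim=> [|{}p {}q pq IH|{}p {}q pq IH].
  - have [-> ->] : den 0 = 1 :> R /\ den 1 = 1 :> R by [].
    rewrite !mul1r /L.
    rewrite (_ : 2 * C / (1 + 1) = C); last by field.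
    by rewrite -addrA lerDl; lra.
  - have := hC _ _ pq; rewrite den_mediant//; set d := _ - (_ + _) => hd.
    have -> : den p * rho (m (mediant p q)) - (den p + den q) * rho (m p) =
      (den p * rho (m q) - den q * rho (m p)) + den p * d by rewrite /d; ring.
    apply: (le_trans (ler_normD _ _)).
    rewrite normrM (ger0_norm (ltW (den_gt0 p))).
    have := key _ _ d (den_ge1 p) (den_ge1 q) hd.
    by rewrite (addrC (den p + den q)) addrA; lra.
  - have := hC _ _ pq; rewrite den_mediant//; set d := _ - (_ + _) => hd.
    have -> : (den p + den q) * rho (m q) - den q * rho (m (mediant p q)) =
      (den p * rho (m q) - den q * rho (m p)) - den q * d by rewrite /d; ring.
    apply: (le_trans (ler_normB _ _)).
    rewrite normrM (ger0_norm (ltW (den_gt0 q))).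
    rewrite (addrC (den p)) in hd IH *.
    by have := key _ _ d (den_ge1 q) (den_ge1 p) hd; lra.
exists L => // p q pq; have := slope _ _ pq.
have n1 := @den_gt0 R p; have n2 := @den_gt0 R q; have d12 := mulr_gt0 n1 n2.
have -> : rho (m q) / den q - rho (m p) / den p =
   (den p * rho (m q) - den q * rho (m p)) / (den p * den q).
  by field; rewrite !lt0r_neq0.
rewrite fpair_sub// normrM normfV (gtr0_norm d12) => h.
rewrite ler_pM2r ?invr_gt0//; apply: (le_trans h).
by rewrite gerBl divr_ge0// ?mulr_ge0 ?ltW// addr_gt0.
Qed.

(** The McShane extension of the values at the rationals shows that an encoding function exists, so
    [encoding], which is chosen by [get], is one; density of the rationals identifies the two on
    [[0, 1]]. *)
Lemma encoding_lipschitz : exists (Phi : R -> R) (L c : R),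
  [/\ 0 <= L, 0 < c, forall x, c <= Phi x,
      forall x y, `|Phi x - Phi y| <= L * `|x - y| &
      (forall q, 0 <= q <= 1 -> Phi (ratr q) = rho (m q) / den q) /\
      (forall x, 0 <= x <= 1 -> encoding m x = Phi x)].
Proof.
have [L L0 hL] := encoding_slope; have [c c0 hc] := rho_lower_bound rm.
set f := fun q => rho (m q) / den q.
have fc q : 0 <= q <= 1 -> c <= f q.
  by move=> /hc h; rewrite ler_pdivlMr ?den_gt0.
have fL := lipschitz_rat hL.
have L0' := ltW L0.
exists (mcshane f L), L, c; split=> //.
- by move=> x; exact: mcshane_ge.
- by move=> x y; exact: mcshane_lip L0' fc x y.
have fq := mcshane_rat L0' fc fL; split => // x x01.
have cphi : continuous (mcshane f L).
  apply: (@lipschitz_continuous _ _ L) => x' y'.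
  exact: mcshane_lip L0' fc x' y'.
have enc : is_encoding m (mcshane f L).
  split=> [y _||//]; first exact/(le_trans (ltW c0))/mcshane_ge.
  exact: continuous_subspaceT.
have [_ ce eq] : is_encoding m (encoding m).
  by apply: (@getPex _ [set Phi | is_encoding m Phi]); exists (mcshane f L).
apply: within_continuous_eq_rat x01 => //; first exact: continuous_subspaceT.
by move=> q q01; rewrite eq// fq.
Qed.

End encoding_exists.

(** * Area of the wedge *)

Section sector.
Context {R : realType}.
Implicit Types (p q h : R) (Phi : R -> R).

(** Half-open in the slope, so that sectors over adjacent intervals are disjoint; for [p <= q] it
    lies in the open right half-plane. *)
Definition sector p q : set (R * R) := [set z | p * z.1 < z.2 <= q * z.1].

Definition strip h : set (R * R) := [set z | z.1 <= h].

(** With [z.1 = r * cos theta] and [z.2 / z.1 = tan theta], the second condition is the polar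
    inequality that bounds the radius of the wedge. *)
Definition wedge_part Phi p q : set (R * R) :=
  sector p q `&` [set z | z.1 * Phi (z.2 / z.1) <= 1].

Lemma measurable_half_plane p : measurable [set z : R * R | z.2 <= p * z.1].
Proof.
rewrite -[X in measurable X]setTI; apply: measurable_fun_le => //.
by apply: measurable_funM => //; exact: measurable_fst.
Qed.

Lemma measurable_sector p q : measurable (sector p q).
Proof.
have -> : sector p q = [set z : R * R | z.2 <= q * z.1] `\` [set z | z.2 <= p * z.1].
  apply/seteqP; split=> z; rewrite /sector /= ltNge.
    by move=> /andP[/negP h1 h2]; split.
  by move=> [-> /negP ->].
by apply: measurableD; exact: measurable_half_plane.
Qed.

Lemma measurable_strip h : measurable (strip h).
Proof. by rewrite -[X in measurable X]setTI; apply: measurable_fun_le. Qed.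

Lemma sector_fst_gt0 p q z : p <= q -> sector p q z -> 0 < z.1.
Proof.
move=> pq /andP[h1 h2]; have h : p * z.1 < q * z.1 by exact: lt_le_trans h2.
rewrite ltNge; apply/negP => z0.
have : q * z.1 <= p * z.1 by rewrite ler_wnM2r.
by rewrite leNgt h.
Qed.

Lemma measurable_wedge_part Phi p q : p <= q -> continuous Phi ->
  measurable (wedge_part Phi p q).
Proof.
move=> pq cPhi.
(* The quotient is treated on the half-plane [z.1 > 0], which contains the sector and on which the
   inverse is continuous. *)
pose D := [set z : R * R | 0 < z.1].
have mD : measurable D.
  rewrite (_ : D = ~` strip 0); first by apply: measurableC; exact: measurable_strip.
  by apply/seteqP; split=> z; rewrite /D /strip /= ltNge => /negP.
have -> : wedge_part Phi p q =
    sector p q `&` (D `&` [set z | z.1 * Phi (z.2 / z.1) <= 1]).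
  by apply/seteqP; split=> z [h1 h2]; split=> //; [split=> //; exact: sector_fst_gt0 h1|case: h2].
apply: measurableI; first exact: measurable_sector.
have mfst : measurable_fun D (@fst R R).
  by apply: measurable_funTS; exact: measurable_fst.
apply: (@measurable_fun_le _ _ R D (fun z => z.1 * Phi (z.2 / z.1)) (cst 1)) => //.
apply: measurable_funM => //; apply: measurableT_comp.
  exact: continuous_measurable_fun.
apply: measurable_funM; first by apply: measurable_funTS; exact: measurable_snd.
apply: (@measurable_comp _ _ _ _ _ _ [set r : R | r != 0]) => //.
- exact: open_measurable.
- by move=> _ [z /= z0 <-]; rewrite gt_eqF.
- apply: open_continuous_measurable_fun => //; apply/in_setP => x /= x0.
  exact: inv_continuous.
Qed.

Lemma integral_linear (k a b : R) : a < b ->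
  (\int[lebesgue_measure]_(x in `[a, b]) (k * x)%:E = (k * (b ^+ 2 - a ^+ 2) / 2)%:E)%E.
Proof.
move=> ab.
pose F (x : R) := k / 2 * x ^+ 2.
have dF (x : R) : is_derive x (1 : R) F (k * x).
  apply: (@is_derive_eq _ _ _ ((k / 2) \*: (fun x : R => x ^+ 2))).
  by rewrite /GRing.scale /=; field.
have cF : continuous F.
  by move=> ?; apply: differentiable_continuous; apply/derivable1_diffP; exact: ex_derive.
rewrite (@continuous_FTC2 _ _ F)//.
- by rewrite /F -EFinB; congr (_%:E); field.
- by apply: continuous_subspaceT; exact: mulrl_continuous.
- split.
  + by move=> x _; exact: ex_derive.
  + by apply: cvg_at_right_filter; exact: cF.
  + by apply: cvg_at_left_filter; exact: cF.
- by move=> x _; rewrite derive1E derive_val.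
Qed.

(** Integration of vertical sections: the one at [x] in [[0, h]] is an interval of length
    [(q - p) * x]. *)
Lemma area_triangle p q h : p < q -> 0 < h ->
  area (sector p q `&` strip h) = ((q - p) * h ^+ 2 / 2)%:E.
Proof.
move=> pq h0; rewrite /area /product_measure1.
transitivity (\int[@lebesgue_measure R]_(x in `[0%R, h]) ((q - p) * x)%R%:E)%E.
  rewrite [RHS]integral_mkcond; apply: eq_integral => x _ /=.
  rewrite patchE; case: ifPn => [|xn].
    rewrite inE /= in_itv/= => /andP[x0 xh].
    have -> : xsection (sector p q `&` strip h) x = `]p * x, q * x]%classic.
      apply/seteqP; split=> y; rewrite /xsection /= inE /sector /strip /= in_itv /=.
        by case.
      by split.
    rewrite lebesgue_measure_itv/= lte_fin.
    (* The interval is empty only at [x = 0], where the integrand vanishes too. *)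
    case: ltP => [_|le]; first by rewrite -EFinB mulrBl.
    suff -> : x = 0 by rewrite mulr0.
    apply/eqP; rewrite eq_le x0 andbT leNgt; apply/negP => xgt0.
    by move: le; rewrite leNgt ltr_pM2r// pq.
  rewrite (_ : xsection _ _ = set0) ?measure0//.
  apply/seteqP; split=> y //; rewrite /xsection /= inE => -[s xh].
  apply: (negP xn); rewrite inE /= in_itv/=.
  by rewrite xh andbT ltW//; exact: (sector_fst_gt0 (ltW pq) s).
rewrite (_ : h ^+ 2 = h ^+ 2 - 0 ^+ 2); last by rewrite expr0n subr0.
exact: integral_linear.
Qed.


Let area_le (A B : set (R * R)) : measurable A -> measurable B -> A `<=` B ->
  (area A <= area B)%E.
Proof. by move=> mA mB AB; apply: le_measure; rewrite ?inE. Qed.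

(** A lower bound [a] on [Phi] confines the part to the triangle cut off at [z.1 = 1 / a]. *)
Lemma area_wedge_part_le Phi p q a : p < q -> continuous Phi -> 0 < a ->
  (forall x, p <= x <= q -> a <= Phi x) ->
  (area (wedge_part Phi p q) <= ((q - p) / (2 * a ^+ 2))%:E)%E.
Proof.
move=> pq cPhi a0 ha.
have -> : (q - p) / (2 * a ^+ 2) = (q - p) * (a^-1) ^+ 2 / 2.
  by field; rewrite lt0r_neq0.
rewrite -area_triangle// ?invr_gt0//; apply: area_le.
- exact: measurable_wedge_part (ltW pq) cPhi.
- by apply: measurableI; [exact: measurable_sector|exact: measurable_strip].
move=> z [zs h]; split=> //; have z0 := sector_fst_gt0 (ltW pq) zs.
rewrite /strip /= -[leRHS]div1r ler_pdivlMr//; apply: le_trans h.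
rewrite ler_pM2l//; apply: ha; case/andP: zs => h1 h2.
by rewrite ler_pdivlMr// ler_pdivrMr// (ltW h1).
Qed.

Lemma area_wedge_part_ge Phi p q b : p < q -> continuous Phi -> 0 < b ->
  (forall x, p <= x <= q -> Phi x <= b) ->
  (((q - p) / (2 * b ^+ 2))%:E <= area (wedge_part Phi p q))%E.
Proof.
move=> pq cPhi b0 hb.
have -> : (q - p) / (2 * b ^+ 2) = (q - p) * (b^-1) ^+ 2 / 2.
  by field; rewrite lt0r_neq0.
rewrite -area_triangle// ?invr_gt0//; apply: area_le.
- by apply: measurableI; [exact: measurable_sector|exact: measurable_strip].
- exact: measurable_wedge_part (ltW pq) cPhi.
move=> z [zs h]; split=> //=; have z0 := sector_fst_gt0 (ltW pq) zs.
move: h; rewrite /strip /= -[leRHS]div1r ler_pdivlMr//; apply: le_trans.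
rewrite ler_pM2l//; apply: hb; case/andP: zs => h1 h2.
by rewrite ler_pdivlMr// ler_pdivrMr// (ltW h1).
Qed.

Lemma area_wedge_partD Phi p q r : p <= q -> q <= r -> continuous Phi ->
  (area (wedge_part Phi p r) =
   area (wedge_part Phi p q) + area (wedge_part Phi q r))%E.
Proof.
move=> pq qr cPhi; rewrite -[RHS]measureU.
- congr (area _); apply/seteqP; split=> z.
    move=> [/[dup] /(sector_fst_gt0 (le_trans pq qr)) z0 /andP[h1 h2] h].
    have [h3|h3] := leP z.2 (q * z.1).
      by left; split=> //; rewrite /sector/= h1.
    by right; split=> //; rewrite /sector/= h3.
  move=> [[/[dup] /(sector_fst_gt0 pq) z0 /andP[h1 h2] h]
        |[/[dup] /(sector_fst_gt0 qr) z0 /andP[h1 h2] h]]; split=> //.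
    by rewrite /sector/= h1 (le_trans h2)// ler_pM2r.
  by rewrite /sector/= h2 andbT (le_lt_trans _ h1)// ler_pM2r.
- exact: measurable_wedge_part.
- exact: measurable_wedge_part.
- apply/seteqP; split=> z // [[/andP[_ h1] _] [/andP[h2 _] _]].
  by move: h2; rewrite ltNge h1.
Qed.

(** With [a] and [b] the extrema of [Phi] on [[p, q]], both compared quantities lie between
    [(q - p) / b ^+ 2] and [(q - p) / a ^+ 2]. Since [b - a <= L * (q - p)] and [a, b >= c], these
    differ by at most the stated error. *)
Lemma area_wedge_part_dist Phi L c p q : p < q -> 0 < c -> 0 <= L ->
  (forall x, c <= Phi x) -> (forall x y, `|Phi x - Phi y| <= L * `|x - y|) ->
  area (wedge_part Phi p q) \is a fin_num /\
  `|2 * fine (area (wedge_part Phi p q)) - (q - p) / (Phi p * Phi q)| <=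
    2 * L / c ^+ 3 * (q - p) ^+ 2.
Proof.
move=> pq c0 L0 Pc PL.
have cPhi := lipschitz_continuous PL; have cw := continuous_subspaceT cPhi.
have [x0] := EVT_min (ltW pq) (cw `[p, q]%classic); rewrite in_itv /= => x0pq hmin.
have [y0] := EVT_max (ltW pq) (cw `[p, q]%classic); rewrite in_itv /= => y0pq hmax.
set a := Phi x0 in hmin; set b := Phi y0 in hmax.
have ca : c <= a := Pc _; have a0 : 0 < a by exact: lt_le_trans ca.
have pI : p \in `[p, q] by rewrite in_itv/=; lra.
have qI : q \in `[p, q] by rewrite in_itv/=; lra.
have ap := hmin _ pI; have aq := hmin _ qI; have pb := hmax _ pI; have qb := hmax _ qI.
have b0 : 0 < b by lra.
have up : (area (wedge_part Phi p q) <= ((q - p) / (2 * a ^+ 2))%:E)%E.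
  by apply: area_wedge_part_le => // x h; apply: hmin; rewrite in_itv.
have lo : (((q - p) / (2 * b ^+ 2))%:E <= area (wedge_part Phi p q))%E.
  by apply: area_wedge_part_ge => // x h; apply: hmax; rewrite in_itv.
have fin : area (wedge_part Phi p q) \is a fin_num.
  by rewrite ge0_fin_numE ?(le_lt_trans up) ?ltry// measure_ge0.
split => //; move: up lo; rewrite -(fineK fin) !lee_fin.
set G := fine _ => up lo.
have ab : b - a <= L * (q - p).
  apply: (le_trans (ler_norm _)); apply: (le_trans (PL _ _)).
  by rewrite ler_wpM2l// ler_norml; lra.
have inv2 : a^-1 ^+ 2 - b^-1 ^+ 2 <= 2 * L / c ^+ 3 * (q - p).
  have -> : a^-1 ^+ 2 - b^-1 ^+ 2 = (b - a) * (a^-1 * b^-1 * (a^-1 + b^-1)).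
    by field; rewrite !lt0r_neq0.
  have ia : a^-1 <= c^-1 by rewrite lef_pV2.
  have ib : b^-1 <= c^-1 by rewrite lef_pV2//; lra.
  have [ia0 ib0] : 0 < a^-1 /\ 0 < b^-1 by rewrite !invr_gt0.
  have -> : 2 * L / c ^+ 3 * (q - p) = L * (q - p) * (c^-1 * c^-1 * (c^-1 + c^-1)).
    by field; rewrite lt0r_neq0.
  apply: ler_pM => //; first lra.
    by rewrite !mulr_ge0//; lra.
  apply: ler_pM => //; [by rewrite mulr_ge0// ltW|lra| |lra].
  by apply: ler_pM => //; exact: ltW.
have pqmid : (q - p) * b^-1 ^+ 2 <= (q - p) / (Phi p * Phi q) <= (q - p) * a^-1 ^+ 2.
  have Pp : 0 < Phi p by lra.
  have Pq : 0 < Phi q by lra.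
  rewrite !ler_pM2l ?subr_gt0// expr2 -invfM expr2 -invfM.
  rewrite !lef_pV2 ?posrE ?mulr_gt0//.
  by apply/andP; split; apply: ler_pM; lra.
have up' : 2 * G <= (q - p) * a^-1 ^+ 2.
  rewrite (_ : _ * a^-1 ^+ 2 = 2 * ((q - p) / (2 * a ^+ 2))); first lra.
  by field; rewrite lt0r_neq0.
have lo' : (q - p) * b^-1 ^+ 2 <= 2 * G.
  rewrite (_ : _ * b^-1 ^+ 2 = 2 * ((q - p) / (2 * b ^+ 2))); first lra.
  by field; rewrite lt0r_neq0.
have qp : 0 <= q - p by lra.
have := ler_wpM2l qp inv2; rewrite mulrBr.
rewrite (_ : 2 * L / c ^+ 3 * (q - p) ^+ 2 = (q - p) * (2 * L / c ^+ 3 * (q - p))); last by ring.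
move: ((q - p) * (2 * L / c ^+ 3 * (q - p))) => K.
move: ((q - p) * a^-1 ^+ 2) ((q - p) * b^-1 ^+ 2) ((q - p) / _) pqmid up' lo'.
by move=> U V W /andP[VW WU] up' lo' UV; clear -VW WU up' lo' UV; rewrite ler_norml /=; lra.
Qed.

End sector.

(** * The wedge in Cartesian coordinates *)

Section wedge.
Context {R : realType} (m : rat -> R) (Phi : R -> R) (c : R).
Hypotheses (c0 : 0 < c) (Pc : forall x, c <= Phi x) (cPhi : continuous Phi).
Hypothesis enc : forall x, 0 <= x <= 1 -> encoding m x = Phi x.

(* At the origin [z.2 / z.1 = 0] and the condition on [Phi] is vacuous. *)
Lemma wedge_cartesian : wedge m =
  [set z : R * R | 0 <= z.2 <= z.1 /\ z.1 * Phi (z.2 / z.1) <= 1].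
Proof.
have pi2 : (pi : R) / 4 < pi / 2 by have := @pi_gt0 R; lra.
have npi2 : - ((pi : R) / 2) < 0 by have := @pi_gt0 R; lra.
have tan01 theta : 0 <= theta <= pi / 4 -> 0 <= (tan theta : R) <= 1.
  move=> /andP[t0 t4].
  have I (x : R) : 0 <= x <= pi / 4 -> x \in `](- (pi / 2)), (pi / 2)[.
    by move=> /andP[? ?]; rewrite in_itv/=; lra.
  have pi40 : 0 <= (pi : R) / 4 by rewrite divr_ge0 ?pi_ge0.
  have It : theta \in `](- (pi / 2)), (pi / 2)[ by apply: I; rewrite t0.
  have I0 : (0 : R) \in `](- (pi / 2)), (pi / 2)[ by apply: I; rewrite lexx.
  have I4 : (pi : R) / 4 \in `](- (pi / 2)), (pi / 2)[ by apply: I; rewrite lexx andbT.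
  by rewrite -tan0 -tan_piquarter !leNgt !ltr_tan// -!leNgt t0.
apply/seteqP; split=> [[x y] /=|[x y] /= [/andP[y0 yx]] h].
  move=> [r [theta [th /andP[r0 rw] [-> ->]]]].
  have cos0 : 0 < cos theta by apply: cos_gt0_pihalf; lra.
  have t01 := tan01 _ th.
  have -> : r * sin theta = tan theta * (r * cos theta).
    by rewrite /tan; field; rewrite lt0r_neq0.
  have rc : 0 <= r * cos theta by rewrite mulr_ge0// ltW.
  split.
    case/andP: t01 => t0 t1.
    by rewrite mulr_ge0//= ler_piMl.
  have [->|rn0] := eqVneq r 0; first by rewrite !mul0r ler01.
  rewrite mulfK; last by rewrite mulf_neq0// lt0r_neq0.
  move: rw; rewrite /wedge_radius enc// ler_pdivlMr ?mulr_gt0//.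
    by rewrite mulrA.
  exact: lt_le_trans (Pc _).
have [x0|xn0] := eqVneq x 0.
  exists 0, 0; rewrite !mul0r !lexx divr_ge0 ?pi_ge0//=; split=> //.
    rewrite /wedge_radius tan0 cos0 !mul1r invr_ge0 enc ?lexx ?ler01//.
    exact: le_trans (ltW c0) (Pc _).
  by congr (_, _) => //; apply/eqP; rewrite eq_le y0 andbT -x0.
have xgt0 : 0 < x by rewrite lt_neqAle eq_sym xn0 (le_trans y0).
have yx01 : 0 <= y / x <= 1.
  by rewrite divr_ge0// ?(ltW xgt0)//= ler_pdivrMr// mul1r.
have cos0 : 0 < cos (atan (y / x)).
  by apply: cos_gt0_pihalf; rewrite atan_gtNpi2 atan_ltpi2.
exists (x / cos (atan (y / x))), (atan (y / x)); split.
- by rewrite -atan0 -atan1; case/andP: yx01 => ? ?; rewrite !le_atan.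
- rewrite divr_ge0 ?(ltW xgt0) ?(ltW cos0)//=.
  rewrite /wedge_radius atanK enc// ler_pdivrMr//.
  have P0 : 0 < Phi (y / x) by exact: lt_le_trans (Pc _).
  rewrite invfM mul1r mulrAC mulVf ?lt0r_neq0// mul1r.
  by rewrite -[leRHS]div1r ler_pdivlMr.
- rewrite divfK ?lt0r_neq0//; congr (_, _).
  have -> : sin (atan (y / x)) = cos (atan (y / x)) * tan (atan (y / x)).
    by rewrite /tan; field; rewrite lt0r_neq0.
  by rewrite atanK; field; rewrite xn0 lt0r_neq0.
Qed.

(** The half-open sector misses only the points of the wedge on the horizontal axis, a segment of
    area zero. *)
Lemma area_wedge : area (wedge m) = area (wedge_part Phi 0 1).
Proof.
rewrite wedge_cartesian.
set Z := [set z : R * R | z.2 = 0 /\ 0 <= z.1 <= (Phi 0)^-1].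
have mW : measurable (wedge_part Phi 0 1) by exact: measurable_wedge_part.
have P0 : 0 < Phi 0 by exact: lt_le_trans (Pc _).
have ZE : Z = `[0, (Phi 0)^-1] `*` [set 0].
  by apply/seteqP; split=> z; rewrite /Z /= in_itv /= => -[].
have mZ : measurable Z by rewrite ZE; apply: measurableX.
have Z0 : area Z = 0%E.
  by rewrite ZE /area product_measure1E// [X in (_ * X)%E](@lebesgue_measure_set1 R 0) mule0.
rewrite -[RHS]adde0 -Z0 -[RHS]measureU//.
- congr (area _); apply/seteqP; split=> z /=.
  + move=> [/andP[z20 z21] h].
    have [e|ne] := eqVneq z.2 0.
      right; split => //; rewrite e mul0r in h.
      rewrite e in z21; rewrite z21 -[leRHS]div1r.
      by rewrite ler_pdivlMr.
    left; split=> //; rewrite /sector /= mul0r mul1r z21 andbT.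
    by rewrite lt_neqAle eq_sym ne.
  + move=> [[s h]|[e /andP[z0 h]]].
      split=> //; move: s; rewrite /sector /= mul0r mul1r => /andP[/ltW-> ->//].
    by rewrite e lexx mul0r; split=> //; rewrite -ler_pdivlMr// div1r.
- apply/seteqP; split=> z // [[+ _] [e _]].
  by rewrite /sector/= e mul0r ltxx.
Qed.

End wedge.

(** * The series *)

Section esum_exhaustion.
Context {R : realType} {T : choiceType} (D : set T) (s : nat -> seq T).
Hypothesis s_uniq : forall n, uniq (s n).
Hypothesis s_mono : forall n, {subset s n <= s n.+1}.
Hypothesis s_cover : forall x, D x <-> exists n, x \in s n.

Let s_le n k : (n <= k)%N -> {subset s n <= s k}.
Proof.
elim: k => [|k IH]; first by rewrite leqn0 => /eqP->.
by rewrite leq_eqVlt => /orP[/eqP->//|/IH h] x /h; exact: s_mono.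
Qed.

Let s_finite (A : set T) : finite_set A -> A `<=` D ->
  exists n, A `<=` [set` s n].
Proof.
move=> /finite_seqP[r ->] /= rD.
elim: r rD => [|x r IH] rD; first by exists 0%N.
have [n hn] : exists n, [set` r] `<=` [set` s n].
  by apply: IH => y yr; apply: rD => /=; rewrite inE; move: yr => /= ->; rewrite orbT.
have [k hk] := (s_cover x).1 (rD x (mem_head _ _)).
exists (maxn n k) => y /=; rewrite inE => /orP[/eqP->|yr].
  by apply: s_le hk; rewrite leq_maxr.
by apply: s_le (hn _ yr); rewrite leq_maxl.
Qed.

(** Every finite subset of [D] is contained in some [s n], so the supremum over finite subsets is
    the supremum, hence the limit, of the nondecreasing partial sums. *)
Lemma esum_exhaustion (f : T -> \bar R) : (forall x, 0 <= f x)%E ->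
  (\sum_(x <- s n) f x)%E @[n --> \oo] --> (\esum_(x in D) f x)%E.
Proof.
move=> f0.
have sub A n : finite_set A -> A `<=` [set` s n] ->
    (\sum_(x \in A) f x <= \sum_(x <- s n) f x)%E.
  move=> fA As; rewrite [leRHS]fsbig_seq//; apply: lee_fsum_nneg_subset => //.
  by move=> x; rewrite !inE; exact: As.
suff -> : (\esum_(x in D) f x)%E = ereal_sup (range (fun n => \sum_(x <- s n) f x)%E).
  apply: ereal_nondecreasing_cvgn => n k nk.
  rewrite [leLHS]fsbig_seq//; apply: sub => //.
  exact: s_le.
apply/eqP; rewrite eq_le; apply/andP; split.
  apply: ge_ereal_sup => _ [A [fA AD] <-].
  have [n An] := s_finite fA AD.
  by apply: (le_trans (sub _ _ fA An)); apply: ereal_sup_ubound; exists n.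
apply: ge_ereal_sup => _ [n _ <-]; apply: esum_ge; exists [set` s n].
  by split => // x xs; apply/s_cover; exists n.
by rewrite [leLHS]fsbig_seq.
Qed.

(** The bound [K] gives summability, so the positive and negative parts have finite sums; each is
    the limit of its partial sums, and the differences of these are the partial sums of [a]. *)
Lemma signed_esum_exhaustion (a : T -> R) (K l : R) :
  (forall n, \sum_(x <- s n) `|a x| <= K) ->
  (\sum_(x <- s n) a x) @[n --> \oo] --> l ->
  summable D (fun x => (a x)%:E) /\ signed_esum D (fun x => (a x)%:E) = l%:E.
Proof.
move=> aK al.
have sm : summable D (fun x => (a x)%:E).
  have h : (\sum_(x <- s n) `|(a x)%:E|)%E @[n --> \oo] --> (\esum_(x in D) `|(a x)%:E|)%E.
    by apply: esum_exhaustion => x; exact: abse_ge0.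
  apply: (@le_lt_trans _ _ K%:E); last exact: ltry.
  rewrite -(cvg_lim _ h)//; apply: lime_le; first by apply/cvg_ex; eexists; exact: h.
  by apply: nearW => n; rewrite sumEFin lee_fin.
split=> //.
have pos x : ((fun x => (a x)%:E) ^\+ x = (Num.max (a x) 0)%:E)%E.
  by rewrite funeposE EFin_max.
have neg x : ((fun x => (a x)%:E) ^\- x = (Num.max (- a x) 0)%:E)%E.
  by rewrite funenegE -EFinN EFin_max.
have Pfin : (\esum_(x in D) (fun x => (a x)%:E) ^\+ x)%E \is a fin_num.
  have := summable_funepos sm; rewrite summableE.
  by under eq_esum do rewrite gee0_abs//.
have Mfin : (\esum_(x in D) (fun x => (a x)%:E) ^\- x)%E \is a fin_num.
  have := summable_funeneg sm; rewrite summableE.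
  by under eq_esum do rewrite gee0_abs//.
have cP : (\sum_(x <- s n) (fun x => (a x)%:E) ^\+ x)%E @[n --> \oo] -->
    (\esum_(x in D) (fun x => (a x)%:E) ^\+ x)%E.
  by apply: esum_exhaustion => x; exact: funepos_ge0.
have cM : (\sum_(x <- s n) (fun x => (a x)%:E) ^\- x)%E @[n --> \oo] -->
    (\esum_(x in D) (fun x => (a x)%:E) ^\- x)%E.
  by apply: esum_exhaustion => x; exact: funeneg_ge0.
(* Finiteness of the positive part rules out a difference of two infinite limits. *)
have := cvgeB (fin_num_adde_defr _ Pfin) cP cM.
have -> : (fun n => (\sum_(x <- s n) (fun x => (a x)%:E) ^\+ x) -
      (\sum_(x <- s n) (fun x => (a x)%:E) ^\- x))%E =
    (fun n => (\sum_(x <- s n) a x)%:E).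
  apply/funext => n.
  under eq_bigr do rewrite pos.
  under [X in (_ - X)%E]eq_bigr do rewrite neg.
  rewrite !sumEFin -EFinB -sumrB; congr (_%:E); apply: eq_bigr => x _.
  by case: (leP (a x) 0) => ?; case: (leP (- a x) 0) => ?; lra.
move=> /(_ _) h; rewrite /signed_esum -(cvg_lim _ h)//; apply/cvg_lim => //.
by apply: cvg_EFin; [exact: nearW|exact: al].
Qed.

End esum_exhaustion.

(** The first [n] levels, in preorder, of the subtree with top vertex [mediant p q]. *)
Fixpoint farey_levels (n : nat) (p q : rat) : seq rat :=
  if n is k.+1 then
    mediant p q :: farey_levels k p (mediant p q) ++ farey_levels k (mediant p q) q
  else [::].

Lemma farey_levels_between n p q x : fpair p q -> x \in farey_levels n p q -> p < x < q.
Proof.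
elim: n p q => // n IH p q pq; have fpq := fpair_neighbours pq.
have pm := mediant_gt fpq; have mq := mediant_lt fpq.
rewrite inE mem_cat => /or3P[/eqP->|/(IH _ _ (fpair_left pq))|/(IH _ _ (fpair_right pq))].
- by rewrite pm.
- by move=> /andP[-> /lt_trans->].
- by move=> /andP[/(lt_trans pm)-> ->].
Qed.

Lemma farey_levels_uniq n p q : fpair p q -> uniq (farey_levels n p q).
Proof.
elim: n p q => // n IH p q pq /=.
have l x := @farey_levels_between n _ _ x (fpair_left pq).
have r x := @farey_levels_between n _ _ x (fpair_right pq).
rewrite mem_cat cat_uniq !IH ?andbT//=; [|exact: fpair_right|exact: fpair_left].
apply/andP; split.
  by apply/norP; split; apply/negP; [move/l|move/r]; rewrite ltxx ?andbF.
apply/hasPn => x /r /andP[h _]; apply/negP => /l /andP[_].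
by rewrite ltNge (ltW h).
Qed.

Lemma farey_levels_mono n p q : {subset farey_levels n p q <= farey_levels n.+1 p q}.
Proof.
elim: n p q => // n IH p q x; rewrite inE mem_cat => /or3P[/eqP->|/IH h|/IH h].
- by rewrite mem_head.
- by rewrite inE mem_cat h orbT.
- by rewrite inE mem_cat h !orbT.
Qed.

Lemma farey_levels_cover x : 0 < x < 1 <-> exists n, x \in farey_levels n 0 1.
Proof.
split=> [/andP[x0 x1]|[n]]; last exact: farey_levels_between fpair_root.
apply: (@fpair_descent x (fun p q => exists n, x \in farey_levels n p q)
  _ _ _ 0 1) => // [p q _ ->|p q _ _ [n hn]|p q _ _ [n hn]|].
- by exists 1%N; rewrite mem_head.
- by exists n.+1; rewrite inE mem_cat hn orbT.
- by exists n.+1; rewrite inE mem_cat hn !orbT.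
- exact: fpair_root.
Qed.

(** * Partial sums of the series over the levels of the tree *)

Section level_sums.
Context {R : realType} (s0 u0 t0 : R) (m : rat -> R).
Hypotheses (mt : markov_tree s0 u0 t0 m) (rm : rising m).

Let a (q : rat) : R := sum_term m q.

Lemma sum_term_mediant p q : fpair p q ->
  a (mediant p q) =
  (rho (m p) + rho (m q) - rho (m (mediant p q))) /
  (rho (m p) * rho (m q) * rho (m (mediant p q))).
Proof.
move=> /fpair_neighbours pq.
by rewrite /a /sum_term parentl_mediant// parentr_mediant.
Qed.

Let r_gt0 p q : fpair p q ->
  [/\ 0 < rho (m p), 0 < rho (m q) & 0 < rho (m (mediant p q))].
Proof.
by move=> /fpair_bounds[p01 q01 x01]; split; apply: rho_m_gt0 => //; lra.
Qed.

(** With [N = den p + den q], the absolute sum below a pair is at most [K * (ratr q - ratr p) / N].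
    Indeed the top term is at most [K * (ratr q - ratr p) * (N^-1 - (N + 1)^-1)], both child pairs
    have denominator sum at least [N + 1], and their lengths add up to that of the pair. *)
Lemma level_sum_bounded : exists K : R,
  forall n, \sum_(x <- farey_levels n 0 1) `|a x| <= K.
Proof.
have [C C0 hC] := excess_decay mt rm; have [c c0 hc] := rho_lower_bound rm.
pose K := 2 * C / c ^+ 3; have c3 : 0 < c ^+ 3 by rewrite exprn_gt0.
have K0 : 0 < K by rewrite divr_gt0// mulr_gt0.
(* The numerator is at most [C / N ^+ 2] and the denominator at least [c ^+ 3 * n * n' * N], where
   [N = n + n']; the factor [2] in [K] absorbs [N + 1 <= 2 * N ^+ 2]. *)
have term p q : fpair p q -> `|a (mediant p q)| <=
    K * (ratr q - ratr p) * ((den p + den q)^-1 - (den p + den q + 1)^-1).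
  move=> pq; rewrite sum_term_mediant// fpair_sub//.
  have [rp rq rx] := r_gt0 pq; have [p01 q01 x01] := fpair_bounds pq.
  have hp := hc _ p01; have hq := hc _ q01.
  have hx : c * den (mediant p q) <= rho (m (mediant p q)) by apply: hc; lra.
  have := hC _ _ pq; rewrite distrC; rewrite den_mediant// in hx *.
  move: (rho (m p)) (rho (m q)) (rho (m (mediant p q))) rp rq rx hp hq hx => u v w.
  have := @den_ge1 R p; have := @den_ge1 R q.
  move: (den p) (den q) => n n' n'1 n1 u0' v0 w0 hu hv hw.
  rewrite normrM normfV (gtr0_norm (x := u * v * w)) ?mulr_gt0//.
  move: `|_| (normr_ge0 (u + v - w)) => d d0 hd.
  have nn0 : 0 < n + n' by lra.
  have h1 : (c * n) * (c * n') * (c * (n + n')) <= u * v * w.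
    by apply: ler_pM; rewrite ?mulr_ge0//; [lra..|apply: ler_pM; rewrite ?mulr_ge0//; lra].
  have p3 : 0 < (c * n) * (c * n') * (c * (n + n')) by rewrite !mulr_gt0//; lra.
  apply: (@le_trans _ _ (d / ((c * n) * (c * n') * (c * (n + n'))))).
    by rewrite ler_wpM2l// lef_pV2// posrE !mulr_gt0.
  apply: (@le_trans _ _ (C / (n + n') ^+ 2 / ((c * n) * (c * n') * (c * (n + n'))))).
    by rewrite ler_pM2r ?invr_gt0// ler_pdivlMr// exprn_gt0.
  have -> : C / (n + n') ^+ 2 / ((c * n) * (c * n') * (c * (n + n'))) =
      (C / (c ^+ 3 * n * n' * (n + n'))) / (n + n') ^+ 2.
    by field; rewrite !lt0r_neq0//; lra.
  have -> : K / (n * n') * ((n + n')^-1 - (n + n' + 1)^-1) =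
      (C / (c ^+ 3 * n * n' * (n + n'))) * (2 / (n + n' + 1)).
    by rewrite /K; field; rewrite !lt0r_neq0//; lra.
  have s1 : 1 <= (n + n') by lra.
  rewrite ler_pM2l; last by rewrite divr_gt0// !mulr_gt0//; lra.
  rewrite -[leLHS]mul1r ler_pdivrMr ?exprn_gt0// mulrAC ler_pdivlMr; last lra.
  have : (n + n') * 1 <= (n + n') * (n + n') by rewrite ler_pM2l.
  by rewrite -expr2; lra.
have bound n p q : fpair p q ->
    \sum_(x <- farey_levels n p q) `|a x| <= K * (ratr q - ratr p) / (den p + den q).
  elim: n p q => [|n IH] p q pq; have := @fpair_sub R _ _ pq;
    have p1 := @den_ge1 R p; have q1 := @den_ge1 R q => e.
    rewrite big_nil e divr_ge0//; last lra.
    by rewrite mulr_ge0 ?(ltW K0)// invr_ge0 mulr_ge0//; lra.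
  rewrite /= big_cons big_cat /=.
  have hl := IH _ _ (fpair_left pq); have hr := IH _ _ (fpair_right pq).
  have ht := term _ _ pq.
  have el := @fpair_sub R _ _ (fpair_left pq); have er := @fpair_sub R _ _ (fpair_right pq).
  have x1 := @den_ge1 R (mediant p q).
  have dl : 0 <= ratr (mediant p q) - ratr p :> R by rewrite el invr_ge0 mulr_ge0//; lra.
  have dr : 0 <= ratr q - ratr (mediant p q) :> R by rewrite er invr_ge0 mulr_ge0//; lra.
  have hl' : K * (ratr (mediant p q) - ratr p) / (den p + den (mediant p q)) <=
      K * (ratr (mediant p q) - ratr p) / (den p + den q + 1).
    rewrite den_mediant//; apply: ler_wpM2l; first by apply: mulr_ge0 => //; exact: ltW.
    by rewrite lef_pV2 ?posrE; lra.
  have hr' : K * (ratr q - ratr (mediant p q)) / (den (mediant p q) + den q) <=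
      K * (ratr q - ratr (mediant p q)) / (den p + den q + 1).
    rewrite den_mediant//; apply: ler_wpM2l; first by apply: mulr_ge0 => //; exact: ltW.
    by rewrite lef_pV2 ?posrE; lra.
  apply: le_trans (lerD ht (lerD (le_trans hl hl') (le_trans hr hr'))) _.
  by rewrite le_eqVlt; apply/orP; left; apply/eqP; ring.
exists (K * (ratr 1 - ratr 0) / (den 0 + den 1)) => n.
exact: bound fpair_root.
Qed.

(** Passing to a child pair raises [den p + den q] by at least [1], which makes up for the level
    lost in [n]; the errors of the two children share one bound on the denominator, and their
    lengths add up. *)
Lemma level_sum_area (Phi : R -> R) (E : R) : continuous Phi -> 0 <= E ->
  (forall p q : R, p < q -> area (wedge_part Phi p q) \is a fin_num /\
    `|2 * fine (area (wedge_part Phi p q)) - (q - p) / (Phi p * Phi q)| <=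
    E * (q - p) ^+ 2) ->
  (forall q, 0 <= q <= 1 -> Phi (ratr q) = rho (m q) / den q) ->
  forall n p q, fpair p q ->
  `|2 * fine (area (wedge_part Phi (ratr p) (ratr q))) -
    (1 / (rho (m p) * rho (m q)) + \sum_(x <- farey_levels n p q) a x)| <=
  E * (ratr q - ratr p) / (den p + den q - 1 + n%:R).
Proof.
move=> cPhi E0 hE PhiE; elim=> [|n IH] p q pq; have [rp rq rx] := r_gt0 pq;
  have p1 := @den_ge1 R p; have q1 := @den_ge1 R q; have [p01 q01 _] := fpair_bounds pq.
  have lt : ratr p < ratr q :> R.
    by rewrite -subr_gt0 fpair_sub// invr_gt0 mulr_gt0//; lra.
  have [_] := hE _ _ lt.
  have -> : (ratr q - ratr p) / (Phi (ratr p) * Phi (ratr q)) =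
      1 / (rho (m p) * rho (m q)).
    by rewrite fpair_sub// !PhiE//; field; rewrite !lt0r_neq0//; lra.
  rewrite big_nil !addr0 => /le_trans; apply.
  rewrite expr2 -mulrA ler_wpM2l// ler_wpM2l ?subr_ge0 ?(ltW lt)//.
  rewrite fpair_sub// lef_pV2 ?posrE ?mulr_gt0//; [|lra..].
  (* This gives [den p + den q - 1 <= den p * den q], whose inverse is the length of the
     interval. *)
  have : 0 <= (den p - 1 : R) * (den q - 1) by rewrite mulr_ge0; lra.
  lra.
have fpq := fpair_neighbours pq.
have pm := mediant_gt fpq; have mq := mediant_lt fpq.
rewrite -(ltr_rat R) in pm; rewrite -(ltr_rat R) in mq.
have [f1 _] := hE _ _ pm; have [f2 _] := hE _ _ mq.
rewrite (area_wedge_partD (ltW pm) (ltW mq) cPhi) fineD//.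
have h1 := IH _ _ (fpair_left pq); have h2 := IH _ _ (fpair_right pq).
rewrite /= big_cons big_cat /= sum_term_mediant//.
set A1 := fine (area (wedge_part Phi (ratr p) _)) in h1 *.
set A2 := fine (area (wedge_part Phi _ (ratr q))) in h2 *.
set S1 := \sum_(_ <- farey_levels n p _) _ in h1 *.
set S2 := \sum_(_ <- farey_levels n _ q) _ in h2 *.
move: (rho (m p)) (rho (m q)) (rho (m (mediant p q))) rp rq rx h1 h2.
move=> u v w u0' v0 w0 h1 h2.
(* The term at the mediant turns the triangle [1 / (u * v)] into the two triangles [1 / (u * w)] and
   [1 / (w * v)]. *)
have -> : 2 * (A1 + A2) - (1 / (u * v) + ((u + v - w) / (u * v * w) + (S1 + S2))) =
    (2 * A1 - (1 / (u * w) + S1)) + (2 * A2 - (1 / (w * v) + S2)).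
  by field; rewrite !lt0r_neq0.
apply: (le_trans (ler_normD _ _)).
have n0 : 0 <= n%:R :> R by [].
have dpos : 0 < den p + den q - 1 + n.+1%:R :> R by rewrite -natr1; lra.
have g1 : E * (ratr (mediant p q) - ratr p) / (den p + den (mediant p q) - 1 + n%:R) <=
    E * (ratr (mediant p q) - ratr p) / (den p + den q - 1 + n.+1%:R).
  rewrite ler_wpM2l ?mulr_ge0//; first by rewrite subr_ge0 ltW.
  by rewrite den_mediant// lef_pV2 ?posrE -?natr1//; lra.
have g2 : E * (ratr q - ratr (mediant p q)) / (den (mediant p q) + den q - 1 + n%:R) <=
    E * (ratr q - ratr (mediant p q)) / (den p + den q - 1 + n.+1%:R).
  rewrite ler_wpM2l ?mulr_ge0//; first by rewrite subr_ge0 ltW.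
  by rewrite den_mediant// lef_pV2 ?posrE -?natr1//; lra.
apply: le_trans (lerD (le_trans h1 g1) (le_trans h2 g2)) _.
move: (den p + den q - 1 + n.+1%:R) dpos => d /lt0r_neq0 d0.
by rewrite le_eqVlt; apply/orP; left; apply/eqP; field.
Qed.

End level_sums.

Theorem proposition6p5 (R : realType) (s0 u0 t0 : R) (m : rat -> R) :
  markov_tree s0 u0 t0 m -> rising m ->
  let D := [set q : rat | 0 < q < 1] in
  let a := fun q : rat => (sum_term m q)%:E in
  summable D a /\
  (2%:E * area (wedge m) =
   (1 / (rho (m 0) * rho (m 1)))%:E + signed_esum D a)%E.
Proof.
move=> mt rm D a.
have [Phi [L [c [L0 c0 Pc PL [PhiE enc]]]]] := encoding_lipschitz mt rm.
have cPhi := lipschitz_continuous PL.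
have E0 : 0 <= 2 * L / c ^+ 3.
  by apply: divr_ge0; [exact: mulr_ge0|exact/exprn_ge0/ltW].
have part p q (pq : p < q) := area_wedge_part_dist pq c0 L0 Pc PL.
have [K hK] := level_sum_bounded mt rm.
have [fin01 _] := part 0 1 ltr01.
rewrite (area_wedge c0 Pc cPhi enc) -(fineK fin01).
set G := fine _.
have lim : (\sum_(x <- farey_levels n 0 1) sum_term m x) @[n --> \oo] -->
    2 * G - 1 / (rho (m 0) * rho (m 1)).
  apply/cvgrPdist_le => e e0.
  (* At the root pair the error after [n] levels is at most [(2 * L / c ^+ 3) / (n + 1)], a multiple
     of the harmonic sequence; the added [1] keeps the divisor positive when [L = 0]. *)
  have := @cvg_harmonic R => /cvgrPdist_le /(_ (e / (2 * L / c ^+ 3 + 1))).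
  have E1 : 0 < 2 * L / c ^+ 3 + 1 by lra.
  rewrite divr_gt0// => /(_ isT); apply: filterS => n.
  rewrite sub0r normrN ger0_norm ?invr_ge0// ler_pdivlMr// => hn.
  have := level_sum_area rm cPhi E0 part PhiE n fpair_root.
  rewrite !rmorph0 !rmorph1 subr0 mulr1.
  have [-> ->] : den 0 = 1 :> R /\ den 1 = 1 :> R by [].
  rewrite addrK nat1r -/G opprD addrA => /le_trans; apply.
  apply: le_trans hn; rewrite mulrC ler_wpM2l ?invr_ge0//; lra.
have [sm ->] := signed_esum_exhaustion (fun n => farey_levels_uniq n fpair_root)
  (fun n => @farey_levels_mono n 0 1) farey_levels_cover hK lim.
by split=> //; rewrite -EFinM -EFinD; congr (_%:E); ring.
Qed.
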